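(* Let $L$ be an $FDD$-lattice. Then $L$ is isomorphic, as a lattice, to $CO(pt(L))$, the collection of compact-open subsets (with respect to the Scott topology) of the poset $pt(L)$ of points of $L$, ordered by inclusion.
   Context: For a bounded lattice $A$, $Cp(A)$ is the set of nonzero co-prime elements, i.e. of $p\neq 0$ such that $p\le x\vee y$ implies $p\le x$ or $p\le y$. Elements $x,y\in A$ are disjoint if $x\wedge y=0$; a finite subset $F\subseteq A$ is disjoint if any two different elements of $F$ are disjoint. A finitely disjunctive distributive lattice ($FDD$-lattice) is a bounded distributive lattice $A$ such that: (1) for each $x\in A$ there is a finite subset $F\subseteq Cp(A)$ with $x=\bigvee F$ (the empty join being $0$); (2) for any $a,b\in Cp(A)$, $a\wedge b$ is the join of a finite disjoint subset (possibly empty) of $Cp(A)$. A point of $A$ is a lattice homomorphism $A\to\{0,1\}$ (preserving $0$, $1$, binary meets and binary joins); $pt(A)$ is the poset of all points of $A$ with the pointwise order ($0<1$). For a poset $P$, a subset $D$ is directed if every finite subset of $D$ (including the empty one) has an upper bound in $D$. A subset $U\subseteq P$ is Scott open if it is an upper set and, for each directed $D$ whose supremum exists, $\bigvee D\in U$ implies $D\cap U\neq\emptyset$; the Scott open sets form the Scott topology. $CO(P)$ denotes the set of subsets of $P$ that are both compact and open in the Scott topology, ordered by inclusion. *)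

(* Defs.v *)
From HB Require Import structures.
From mathcomp Require Import all_boot all_order finmap.
From mathcomp Require Import boolp classical_sets functions cardinality.
From mathcomp Require Import topology.

Set Implicit Arguments.
Unset Strict Implicit.
Unset Printing Implicit Defensive.

Import Order.TTheory.
Local Open Scope classical_set_scope.
Local Open Scope order_scope.

(* Nonzero co-prime elements. *)
Definition Cp d (A : tbLatticeType d) : set A :=
  [set p | p != \bot /\ forall x y : A, p <= x `|` y -> p <= x \/ p <= y].

Definition disjoint_fset d (A : tbLatticeType d) (F : {fset A}) : Prop :=
  forall x y : A, x \in F -> y \in F -> x != y -> x `&` y = \bot.

(* Finitely disjunctive distributive lattices. *)
Definition FDD d (A : tbDistrLatticeType d) : Prop :=
  (forall x : A, exists F : {fset A},
     (forall p, p \in F -> Cp p) /\ x = \join_(p <- F) p) /\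
  (forall a b : A, Cp a -> Cp b -> exists F : {fset A},
     [/\ forall p, p \in F -> Cp p, disjoint_fset F
       & a `&` b = \join_(p <- F) p]).

(* MathComp's {tblmorphism A -> bool} is not used here: in this version of the
   library it only records preservation of \bot and \top. *)
Definition is_point d (A : tbLatticeType d) : set (A -> bool) :=
  [set f | [/\ f \bot = false, f \top = true,
               {morph f : x y / x `&` y >-> x && y}
             & {morph f : x y / x `|` y >-> x || y}]].

Definition pt d (A : tbLatticeType d) : Type := set_type (@is_point d A).

Fact pt_display : Order.disp_t. Proof. by []. Qed.

Section PointOrder.
Context d (A : tbLatticeType d).
Implicit Types f g h : pt A.

HB.instance Definition _ := Choice.on (pt A).

Definition le_pt f g : bool := `[< forall x : A, val f x <= val g x >].

Fact le_pt_refl : reflexive le_pt.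
Proof. by move=> f; apply/asboolP. Qed.

Fact le_pt_anti : antisymmetric le_pt.
Proof.
move=> f g /andP[/asboolP fg /asboolP gf].
by apply/val_inj/funext => x; apply/le_anti; rewrite fg gf.
Qed.

Fact le_pt_trans : transitive le_pt.
Proof.
move=> g f h /asboolP fg /asboolP gh.
by apply/asboolP => x; exact: le_trans (fg x) (gh x).
Qed.

HB.instance Definition _ :=
  Order.Le_isPOrder.Build pt_display (pt A) le_pt_refl le_pt_anti le_pt_trans.

End PointOrder.

Definition directed d (P : porderType d) (D : set P) : Prop :=
  forall F : set P, finite_set F -> (F `<=` D)%classic ->
    exists2 u, D u & ubound F u.

Definition scott_open d (P : porderType d) : set (set P) :=
  [set U | (forall x y : P, x <= y -> U x -> U y) /\
           (forall (D : set P) (s : P), directed D -> supremums D s -> U s ->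
              exists2 x, D x & U x)].

(* P equipped with its Scott topology. *)
Definition scott d (P : porderType d) : Type := P.

Section ScottTopology.
Context d (P : porderType d).

HB.instance Definition _ := Order.POrder.on (scott P).

Fact scott_openT : @scott_open d P setT.
Proof.
split=> // D s dD _ _.
by have [u Du _] := dD set0 (finite_set0 _) (@sub0set _ _); exists u.
Qed.

Fact scott_openI : setI_closed (@scott_open d P).
Proof.
move=> U V [upU sU] [upV sV]; split=> [x y xy [Ux Vx]|D s dD Ds [Us Vs]].
  by split; [exact: upU xy Ux|exact: upV xy Vx].
have [a Da Ua] := sU D s dD Ds Us; have [b Db Vb] := sV D s dD Ds Vs.
have [||u Du ub] := dD [set a; b]%classic.
- exact: finite_set2.
- by move=> _ [->|->].
exists u => //; split.
- by apply: (upU a) => //; apply: ub; left.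
- by apply: (upV b) => //; apply: ub; right.
Qed.

Fact scott_open_bigU (I : Type) (U : I -> set P) :
  (forall i, scott_open (U i)) -> scott_open (\bigcup_i U i).
Proof.
move=> oU; split=> [x y xy [i _ Ux]|D s dD Ds [i _ Us]].
  by exists i => //; exact: (oU i).1 xy Ux.
by have [x Dx Ux] := (oU i).2 D s dD Ds Us; exists x => //; exists i.
Qed.

HB.instance Definition _ := isOpenTopological.Build (scott P)
  scott_openT scott_openI scott_open_bigU.

End ScottTopology.

(* cover_compact rather than compact: the filter-based and cover-based notions
   are proved equal in the library for pointed spaces only, while P may be
   empty. *)
Definition scott_compact_open d (P : porderType d) : set (set (scott P)) :=
  [set U | cover_compact U /\ open U].

Definition CO d (P : porderType d) : Type := set_type (@scott_compact_open d P).

(* The order on CO P is the restriction of the inclusion order of set. *)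
HB.instance Definition _ d (P : porderType d) :=
  SubChoice.on (CO P).
HB.instance Definition _ d (P : porderType d) :=
  [SubChoice_isSubPOrder of CO P by <: with set_display].

Definition is_lattice d (Q : porderType d) : Prop :=
  forall x y : Q, (infimums [set x; y]%classic !=set0)%classic /\
                  (supremums [set x; y]%classic !=set0)%classic.

(* Q carries no chosen meet and join operations: they are the binary infima
   and suprema of its order. *)
Definition lattice_isomorphic d (A : latticeType d) d' (Q : porderType d') :
    Prop :=
  is_lattice Q /\
  exists phi : A -> Q,
    [/\ bijective phi,
        forall x y, infimums [set phi x; phi y]%classic (phi (x `&` y))
      & forall x y, supremums [set phi x; phi y]%classic (phi (x `|` y))].

(* Main.v *)
Require Import Defs.
From mathcomp Require Import all_boot all_order.
From mathcomp Require Import finmap boolp classical_sets cardinality topology.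

(** Stone duality for bounded lattices in which every element is a finite join
    of co-primes.
    A co-prime [p] is the same thing as a point whose prime filter is principal:
    [prime_pt p] sends [x] to [p <= x]. Write [basic x] for the set of points
    [f] with [f x = 1]; the isomorphism is [basic].

    - Each [basic x] is Scott open because directed suprema of points are
      computed pointwise: a directed union of prime filters is a prime filter
      ([directed_sup_ptE]).
    - Each [basic x] is compact: [basic p] is the principal up-set of
      [prime_pt p] when [p] is co-prime, and [basic] turns a decomposition of
      [x] as a finite join of co-primes into a finite union of such up-sets.
    - [basic] is an order embedding: every co-prime [p] in a decomposition of
      [x] gives a point [prime_pt p] of [basic x], so [basic x `<=` basic y]
      forces [p <= y] ([basic_subset]).
    - The sets [basic x] form a basis: every point [f] is the directed supremum
      of the [prime_pt p] with [f p = 1], and a Scott open neighbourhood of [f]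
      contains one of these, hence all of its up-set [basic p]
      ([scott_open_basic]). A compact open set is therefore a finite union of
      sets [basic x], which is [basic] of the finite join.

    An order isomorphism preserves binary meets and joins, and these exist in
    its codomain as soon as they exist in its domain. *)

Set Implicit Arguments.
Unset Strict Implicit.
Unset Printing Implicit Defensive.

Import Order.TTheory.
Local Open Scope classical_set_scope.
Local Open Scope order_scope.

(** * Posets *)

Lemma directed2 d (P : porderType d) (D : set P) a b :
  directed D -> D a -> D b -> exists2 c, D c & a <= c /\ b <= c.
Proof.
move=> dD Da Db; have [||c Dc ubc] := dD [set a; b].
- exact: finite_set2.
- by move=> _ [->|->].
- by exists c => //; split; apply: ubc; [left|right].
Qed.

Lemma directed_neq0 d (P : porderType d) (D : set P) : directed D -> D !=set0.
Proof.
by move=> dD; have [c Dc _] := dD set0 (finite_set0 _) (@sub0set _ _); exists c.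
Qed.

Lemma binary_directed d (P : porderType d) (D : set P) :
  D !=set0 ->
  (forall a b, D a -> D b -> exists2 c, D c & a <= c /\ b <= c) ->
  directed D.
Proof.
move=> [a0 Da0] D2 F /finite_seqP[s ->{F}].
elim: s => [|a s IHs] sD; first by exists a0 => // x; rewrite /= in_nil.
have [|b Db ubb] := IHs; first by move=> x xs; apply: sD; rewrite /= inE xs orbT.
have [c Dc [ac bc]] := D2 a b (sD a (mem_head a s)) Db.
exists c => // x; rewrite /= inE => /predU1P[->//|xs].
exact: le_trans (ubb x xs) bc.
Qed.

(** Infima and suprema are invariants of the order, so those of [A] are
    transported by any order isomorphism. *)
Lemma order_iso_lattice d (A : latticeType d) d' (Q : porderType d')
    (phi : A -> Q) :
  {mono phi : x y / x <= y} -> (forall q, exists x, phi x = q) ->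
  lattice_isomorphic A Q.
Proof.
move=> phi_mono phi_surj.
have phiI x y : infimums [set phi x; phi y] (phi (x `&` y)).
  split=> [_ [->|->]|q lbq]; rewrite ?phi_mono ?leIl ?leIr //.
  have [z zq] := phi_surj q; rewrite -zq phi_mono lexI -!phi_mono zq.
  by apply/andP; split; apply: lbq; [left|right].
have phiU x y : supremums [set phi x; phi y] (phi (x `|` y)).
  split=> [_ [->|->]|q ubq]; rewrite ?phi_mono ?leUl ?leUr //.
  have [z zq] := phi_surj q; rewrite -zq phi_mono leUx -!phi_mono zq.
  by apply/andP; split; apply: ubq; [left|right].
split.
  move=> p q; have [x <-] := phi_surj p; have [y <-] := phi_surj q.
  by split; [exists (phi (x `&` y))|exists (phi (x `|` y))].
exists phi; split=> //; have [psi psiK] := choice phi_surj.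
by exists psi => // x; apply/(inc_inj phi_mono)/psiK.
Qed.

(** * Cover compactness *)

Lemma cover_compact0 (T : topologicalType) : cover_compact (set0 : set T).
Proof. by move=> I D f _ _; exists fset0 => // i; rewrite in_fset0. Qed.

Lemma cover_compactU (T : topologicalType) (A B : set T) :
  cover_compact A -> cover_compact B -> cover_compact (A `|` B).
Proof.
move=> cA cB I D f oD; rewrite subUset => -[/(cA I D f oD)[E ED AE]].
move=> /(cB I D f oD)[F FD BF]; exists (E `|` F)%fset.
  by move=> i; rewrite in_fsetU => /orP[/ED|/FD].
move=> x [/AE|/BF] [i /= iEF fix_]; exists i => //=.
  by rewrite in_fsetU iEF.
by rewrite in_fsetU iEF orbT.
Qed.

(** Any open set that contains the least element of the up-set contains all of
    it, so one member of a cover suffices. *)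
Lemma cover_compact_up d (P : porderType d) (a : P) :
  cover_compact ([set x | a <= x] : set (scott P)).
Proof.
move=> I D f oD cov; have [i Di fia] := cov a (lexx a).
exists [fset i]%fset; first by move=> j; rewrite in_fset1 => /eqP->; rewrite inE.
by move=> x ax; exists i; [rewrite /= in_fset1|exact: (oD i Di).1 ax fia].
Qed.

(** * Points of a bounded lattice *)

Section Points.
Context d (A : tbLatticeType d).
Implicit Types (f g : pt A) (x y p : A).

Definition mk_pt (h : A -> bool) (hP : is_point h) : pt A := SigSub (mem_set hP).

Lemma pt_le f g : (f <= g) <-> (forall x, val f x -> val g x).
Proof.
split=> [/asboolP fg x|fg].
  by have := fg x; rewrite leEbool; case: (val f x) => //; case: (val g x).
apply/asboolP => x; have := fg x; rewrite leEbool.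
by case: (val f x) => // ->.
Qed.

Lemma pt_bot f : val f \bot = false.
Proof. by have [] := set_valP f. Qed.

Lemma pt_top f : val f \top = true.
Proof. by have [] := set_valP f. Qed.

Lemma ptI f x y : val f (x `&` y) = val f x && val f y.
Proof. by have [] := set_valP f. Qed.

Lemma ptU f x y : val f (x `|` y) = val f x || val f y.
Proof. by have [] := set_valP f. Qed.

Lemma pt_homo f x y : x <= y -> val f x -> val f y.
Proof. by move=> /join_idPl <-; rewrite ptU orbC => ->. Qed.

Lemma pt_joins f (s : seq A) : val f (\join_(p <- s) p) = has (val f) s.
Proof.
elim: s => [|p s IHs] /=; first by rewrite big_nil pt_bot.
by rewrite big_cons ptU IHs.
Qed.

(** The union of a directed family of prime filters is again a prime filter, so
    it is the least upper bound of the family. *)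
Lemma directed_sup_ptE (D : set (pt A)) (g : pt A) :
  directed D -> supremums D g ->
  forall x, val g x -> exists2 f, D f & val f x.
Proof.
move=> dD [_ gmin]; pose u x := `[< exists2 f, D f & val f x >].
have uP : is_point u.
  split.
  - by apply/asboolP => -[f _]; rewrite pt_bot.
  - by apply/asboolP; have [f Df] := directed_neq0 dD; exists f; rewrite ?pt_top.
  - move=> x y; apply/asboolP/andP=> [[f Df]|].
      by rewrite ptI => /andP[fx fy]; split; apply/asboolP; exists f.
    move=> [/asboolP[f Df fx] /asboolP[f' Df' f'y]].
    have [h Dh [/pt_le fh /pt_le f'h]] := directed2 dD Df Df'.
    by exists h; rewrite // ptI fh ?f'h.
  - move=> x y; apply/asboolP/orP=> [[f Df]|].
      by rewrite ptU => /orP[fx|fy]; [left|right]; apply/asboolP; exists f.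
    by move=> [|] /asboolP[f Df fx]; exists f; rewrite // ptU fx ?orbT.
have gu : g <= mk_pt uP.
  by apply: gmin => f Df; apply/pt_le => x fx; apply/asboolP; exists f.
by move=> x gx; have /asboolP := (pt_le _ _).1 gu x gx.
Qed.

Fact prime_pt_subproof p : Cp p -> is_point (fun x => p <= x).
Proof.
move=> [p0 pcop]; split; rewrite ?lex1 ?lex0 //; first exact/negbTE.
  by move=> x y; rewrite lexI.
move=> x y; apply/idP/orP; first exact: pcop.
by move=> [|] px; [apply: lexUl|apply: lexUr].
Qed.

Definition prime_pt p (cp : Cp p) : pt A := mk_pt (prime_pt_subproof cp).

Lemma prime_pt_le p (cp : Cp p) f : (prime_pt cp <= f) = val f p.
Proof.
apply/idP/idP => [/pt_le/(_ p)|fp]; first by apply; exact: lexx.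
by apply/pt_le => x px; exact: pt_homo fp.
Qed.

(** * The basic compact open sets *)

Definition basic x : set (scott (pt A)) := [set f : pt A | val f x].

Lemma basic_bot : basic \bot = set0.
Proof. by apply/seteqP; split=> // f; rewrite /basic /= pt_bot. Qed.

Lemma basicU x y : basic (x `|` y) = basic x `|` basic y.
Proof.
apply/seteqP; split=> f; rewrite /basic /= ptU; first by move/orP.
by move=> ?; apply/orP.
Qed.

Lemma open_basic x : open (basic x).
Proof.
split=> [f g /pt_le fg|D g dD Dg gx]; first exact: fg.
exact: directed_sup_ptE gx.
Qed.

Lemma cover_compact_basic_joins (s : seq A) :
  {in s, forall p, Cp p} -> cover_compact (basic (\join_(p <- s) p)).
Proof.
elim: s => [|p s IHs] sCp.
  by rewrite big_nil basic_bot; exact: cover_compact0.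
rewrite big_cons basicU; apply: cover_compactU; last first.
  by apply: IHs => q qs; apply: sCp; rewrite inE qs orbT.
have cp : Cp p by apply: sCp; rewrite mem_head.
suff -> : basic p = [set f | prime_pt cp <= f] by exact: cover_compact_up.
by apply/seteqP; split=> f; rewrite /basic /= prime_pt_le.
Qed.

End Points.

(** * Lattices generated by co-prime elements *)

Section Generated.
Context d (L : tbLatticeType d).
Context (joinCp : forall x : L, exists F : {fset L},
  (forall p, p \in F -> Cp p) /\ x = \join_(p <- F) p).
Implicit Types (f : pt L) (x y p : L).

(** Primality of the filter of [f], applied to a decomposition of [x]. *)
Lemma pt_Cp f x : val f x -> exists p, [/\ Cp p, p <= x & val f p].
Proof.
have [F [FCp ->]] := joinCp x; rewrite pt_joins => /hasP[p pF fp].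
by exists p; split=> //; [exact: FCp|exact: joins_sup_seq].
Qed.

(** The points [prime_pt p], for [p] in a decomposition of [x], detect whether
    [x] lies below a given element. *)
Lemma basic_subset x y : (basic x `<=` basic y) <-> (x <= y).
Proof.
split=> [xy|xy f]; last exact: pt_homo.
have [F [FCp xE]] := joinCp x; rewrite xE; apply/joinsP_seq => p pF _.
apply: (xy (prime_pt (FCp p pF))).
by rewrite /basic /= xE; exact: (joins_sup_seq id pF).
Qed.

Lemma cover_compact_basic x : cover_compact (basic x).
Proof. by have [F [FCp ->]] := joinCp x; exact: cover_compact_basic_joins. Qed.

Definition prime_below f : set (pt L) :=
  [set g | exists p (cp : Cp p), val f p /\ g = prime_pt cp].

(** Two co-primes in the filter of [f] have their meet in it, and then a
    co-prime below that meet. *)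
Lemma prime_below_directed f : directed (prime_below f).
Proof.
apply: binary_directed.
  have [p [cp _ fp]] := pt_Cp (pt_top f).
  by exists (prime_pt cp), p, cp.
move=> _ _ [p [cp [fp ->]]] [q [cq [fq ->]]].
have [|r [cr + fr]] := @pt_Cp f (p `&` q); first by rewrite ptI fp fq.
rewrite lexI => /andP[rp rq]; exists (prime_pt cr); first by exists r, cr.
by rewrite !prime_pt_le.
Qed.

Lemma prime_below_sup f : supremums (prime_below f) f.
Proof.
split=> [_ [p [cp [fp ->]]]|g ubg]; first by rewrite prime_pt_le.
apply/pt_le => x /pt_Cp[p [cp px fp]]; apply: pt_homo px _.
by rewrite -(prime_pt_le cp); apply: ubg; exists p, cp.
Qed.

(** Being inaccessible by directed suprema, [U] meets [prime_below f], and
    the up-set of a point [prime_pt p] is [basic p]. *)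
Lemma scott_open_basic (U : set (scott (pt L))) f :
  open U -> U f -> exists2 x, val f x & basic x `<=` U.
Proof.
move=> [upU supU] Uf.
have [_ [p [cp [fp ->]]] Up] :=
  supU _ _ (@prime_below_directed f) (prime_below_sup f) Uf.
by exists p => // g gp; apply: upU Up; rewrite prime_pt_le.
Qed.

Lemma compact_open_basic (U : set (scott (pt L))) :
  cover_compact U -> open U -> exists x, basic x = U.
Proof.
move=> cU oU.
(* The cover is indexed by the elements of [L] themselves. *)
have [||F FU UF] := cU L [set x | basic x `<=` U] (@basic _ L).
- by move=> x _; exact: open_basic.
- by move=> f /(scott_open_basic oU)[x fx xU]; exists x.
exists (\join_(x <- F) x); apply/seteqP; split=> f; rewrite /basic /= pt_joins.
  by move=> /hasP[x /FU]; rewrite inE; apply.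
by move=> /UF[x xF fx]; apply/hasP; exists x.
Qed.

Definition basic_CO x : CO (pt L) :=
  SigSub (mem_set (conj (@cover_compact_basic x) (@open_basic _ _ x))).

Lemma generated_lattice_isomorphic : lattice_isomorphic L (CO (pt L)).
Proof.
apply: (@order_iso_lattice _ _ _ _ basic_CO) => [x y|U].
  rewrite -[LHS]/(basic x <= basic y).
  by apply/idP/idP; rewrite subsetEset => /basic_subset.
have [cU oU] := set_valP U; have [x xU] := compact_open_basic cU oU.
by exists x; exact: val_inj.
Qed.

End Generated.

Theorem theorem3p11 (d : Order.disp_t) (L : tbDistrLatticeType d) :
  FDD L -> lattice_isomorphic L (CO (pt L)).
Proof.
by move=> [joinCp _]; exact: generated_lattice_isomorphic joinCp.
Qed.
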